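(* Let $p$ be an odd prime, $r$ a positive integer, $\zeta_{p^r}$ a primitive $p^r$-th root of unity, and $\ell$ a square-free positive integer. There exists an Arakelov-modular lattice of level $\ell$ over $\mathbb{Q}(\zeta_{p^r}+\zeta_{p^r}^{-1})$ if and only if $\ell\in\mathrm{Mod}(p^r)$, where $\mathrm{Mod}(p^r)$ is given by \begin{itemize} \item[1.] $\mathrm{Mod}(p^r)=\{1,p\}$, if $p\equiv 1\pmod 4$; \item[2.] $\mathrm{Mod}(p^r)=\{1\}$, if $p\equiv 3\pmod 4$. \end{itemize}
   Context: Let $K$ be a totally real number field with ring of integers $\mathcal{O}_K$ and different $\mathcal{D}_K$ over $\mathbb{Q}$. An element $\alpha\in K^\times$ is totally positive if $\sigma(\alpha)>0$ for every embedding $\sigma:K\to\mathbb{R}$. An ideal lattice over $K$ is a pair $(I,\alpha)$, where $I$ is a (nonzero) fractional $\mathcal{O}_K$-ideal, $\alpha\in K^\times$ is totally positive, and $I$ carries the positive definite symmetric bilinear form $b_\alpha(x,y)=\mathrm{Tr}_{K/\mathbb{Q}}(\alpha xy)$. Its dual is $(I^*,\alpha)$ with $I^*=\alpha^{-1}\mathcal{D}_K^{-1}I^{-1}=\{x\in K: b_\alpha(x,y)\in\mathbb{Z}\ \forall y\in I\}$. For a positive integer $\ell$, $(I,\alpha)$ is Arakelov-modular of level $\ell$ if there exists $\beta\in K^\times$ such that $I=\beta I^*$ and $\ell=\beta^2$. *)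

(* Defs.v *)
From HB Require Import structures.
From mathcomp Require Import all_boot all_order all_algebra all_field.
From mathcomp Require Import classical_sets reals.

Set Implicit Arguments.
Unset Strict Implicit.
Unset Printing Implicit Defensive.

Import Order.TTheory GRing.Theory Num.Theory.

Local Open Scope classical_set_scope.
Local Open Scope ring_scope.

(* A number field is represented as a [fieldExtType rat]. *)

Definition ring_of_integers (K : fieldExtType rat) : set K :=
  [set x | integralOver (intr : int -> K) x].

(* Trace over Q of the multiplication-by-x endomorphism of K, on the basis
   [vbasis {:K}]. *)
Definition field_trace (K : fieldExtType rat) (x : K) : rat :=
  let b := vbasis {:K} in
  \tr (\matrix_(i < \dim {:K}, j < \dim {:K}) coord b j (x * b`_i)).

(* The real numbers are represented by an arbitrary [realType] (all of them
   are isomorphic). *)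
Definition totally_positive (R : realType) (K : fieldExtType rat) (a : K) :=
  a != 0 /\ forall sigma : {rmorphism K -> R}, 0 < sigma a.

Definition fractional_ideal (K : fieldExtType rat) (I : set K) :=
  [/\ exists2 x, I x & x != 0,
      forall x y, I x -> I y -> I (x + y),
      forall a x, ring_of_integers a -> I x -> I (a * x) &
      exists d : K, [/\ ring_of_integers d, d != 0 &
        forall x, I x -> ring_of_integers (d * x)]].

Definition trace_form (K : fieldExtType rat) (a x y : K) : rat :=
  field_trace (a * x * y).

Definition ideal_lattice (R : realType) (K : fieldExtType rat)
    (I : set K) (a : K) :=
  fractional_ideal I /\ totally_positive R a.

Definition dual_ideal (K : fieldExtType rat) (I : set K) (a : K) : set K :=
  [set x | forall y, I y -> trace_form a x y \is a Num.int].

Definition arakelov_modular (K : fieldExtType rat) (l : nat)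
    (I : set K) (a : K) :=
  exists b : K, [/\ b != 0,
    I = [set b * x | x in dual_ideal I a] & l%:R = b ^+ 2].

Definition square_free (n : nat) := forall d : nat, (d ^ 2 %| n)%N -> d = 1%N.

(* The field Q(z + z^-1), as a number field in its own right. *)
Definition real_subfield (L : fieldExtType rat) (z : L) : fieldExtType rat :=
  subvs_of <<1; z + z^-1>>%AS.

(* Mod(p^r) for an odd prime p; it depends on p only. *)
Definition Mod (p : nat) : seq nat :=
  if (p %% 4 == 1)%N then [:: 1%N; p]
  else if (p %% 4 == 3)%N then [:: 1%N]
  else [::].

(* Main.v *)
Require Import Defs.
From HB Require Import structures.
From mathcomp Require Import all_boot all_order all_algebra all_field.
From mathcomp Require Import classical_sets reals.
From mathcomp Require Import ring lra zify.

Set Implicit Arguments.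
Unset Strict Implicit.
Unset Printing Implicit Defensive.

Import Order.TTheory GRing.Theory Num.Theory.

Local Open Scope classical_set_scope.
Local Open Scope ring_scope.

(** Write N = p^r, K = Q(t) with t = z + z^-1, lam = 2 - t, n = [K : Q], and
    let O be the ring of integers of K.

    The prime p is totally ramified in K and lam generates the prime above it.
    Indeed p is the product of the conjugates 2 - (z^k + z^-k) of lam, and each
    of them is lam times the square of a unit of Z[t], so that p = lam^n w^2
    with w a unit ([p_lam], [w_unit]).  The square comes from writing
    z = y^2 with y a power of z: then 2 - (z^k + z^-k) is -(y^k - y^-k)^2.
    Eisenstein's argument in powers of lam shows that the conjugates of t are
    exactly the n numbers z^k + z^-k with 0 < k < N/2 prime to p, which gives
    [K : Q] = n, the automorphisms of K, and the trace as the sum of the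
    conjugates ([t_free], [dim_K], [field_traceE]).

    Orthogonality of the characters of Z/N gives the inversion formula
    N x = 2 Tr(x) + sum_j Tr(x c_j) c_j with c_j = z^j + z^-j
    ([trace_inversion]).  It puts N O in Z[t], hence O = Z[t] ([O_Zt]), and N M
    in O, where M is the codifferent; as O/lam is the prime field, M = lam^-d O
    for some d ([codiffE]).

    Existence.  On I = O with the totally positive a = lam^(e-d), the dual is
    lam^-e O, so that (O, a) is modular of level l as soon as
    l = (lam^e v)^2 with v a unit ([modular_exists]).  Level 1 has e = 0 and
    v = 1; level p has e = n/2 and v = w, which requires n to be even, that is
    p = 1 mod 4.

    Necessity.  It only uses that l = b^2 with b in K.  The conjugates of b are
    b and -b, hence Tr(b g) is b times an integer of K and its square is
    divisible by l; a prime s dividing l therefore divides every Tr(b g), and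
    by the inversion formula it divides N b.  So s^2 divides N^2 l, and
    s = p because l is square-free ([prime_dvd_level]).  Finally l = p makes
    Q(b) quadratic, which forces n to be even ([level_p_even]). *)

(** * Chebyshev recurrences *)
Fixpoint linrec (R : comNzRingType) (a b x : R) (k : nat) : R :=
  if k is k'.+1 then linrec b (x * b - a) x k' else a.

(** Dickson polynomials of parameter 1 of the first and second kind, that is
    2 T_k(x/2) and U_(k-1)(x/2) for the Chebyshev polynomials T and U: the
    values y^k + y^-k and (y^k - y^-k)/(y - y^-1) at x = y + y^-1.  The index
    of the second kind is shifted so that both sequences are read off powers
    with the same exponent. *)
Definition dickson (R : comNzRingType) (x : R) k := linrec 2 x x k.
Definition dicksonU (R : comNzRingType) (x : R) k := linrec 0 1 x k.

Lemma linrecSS (R : comNzRingType) (a b x : R) k :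
  linrec a b x k.+2 = x * linrec a b x k.+1 - linrec a b x k.
Proof. by elim: k a b => [|k IH] a b //; rewrite -[LHS]/(linrec b (x * b - a) x k.+2) IH. Qed.

Lemma rmorph_linrec (R S : comNzRingType) (f : {rmorphism R -> S}) a b x k :
  f (linrec a b x k) = linrec (f a) (f b) (f x) k.
Proof. by elim: k a b => [|k IH] a b //=; rewrite IH rmorphB rmorphM. Qed.

Lemma rmorph_dickson (R S : comNzRingType) (f : {rmorphism R -> S}) x k :
  f (dickson x k) = dickson (f x) k.
Proof. by rewrite /dickson rmorph_linrec rmorph_nat. Qed.

Lemma rmorph_dicksonU (R S : comNzRingType) (f : {rmorphism R -> S}) x k :
  f (dicksonU x k) = dicksonU (f x) k.
Proof. by rewrite /dicksonU rmorph_linrec rmorph0 rmorph1. Qed.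

Lemma nat_ind2 (P : nat -> Prop) :
  P 0%N -> P 1%N -> (forall k, P k -> P k.+1 -> P k.+2) -> forall k, P k.
Proof.
move=> P0 P1 PS k; suff: P k /\ P k.+1 by case.
by elim: k => [|k [IH1 IH2]]; split => //; apply: PS.
Qed.

Lemma dicksonE (R : comNzRingType) (y y' : R) k :
  y * y' = 1 -> dickson (y + y') k = y ^+ k + y' ^+ k.
Proof.
move=> yy'; elim/nat_ind2: k => [|//|k IH1 IH2].
  by rewrite /dickson /= !expr0.
rewrite /dickson linrecSS -!/(dickson _ _) IH1 IH2 !exprS.
by ring: yy'.
Qed.

Lemma dicksonUE (R : comNzRingType) (y y' : R) k :
  y * y' = 1 -> (y - y') * dicksonU (y + y') k = y ^+ k - y' ^+ k.
Proof.
move=> yy'; elim/nat_ind2: k => [||k IH1 IH2].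
- by rewrite /dicksonU /= !expr0 subrr mulr0.
- by rewrite /dicksonU /= !expr1 mulr1.
rewrite /dicksonU linrecSS -!/(dicksonU _ _) mulrBr IH1 mulrCA IH2 !exprS.
by ring: yy'.
Qed.

Lemma dickson2 (R : comNzRingType) k : dickson (2 : R) k = 2.
Proof.
have -> : (2 : R) = 1 + 1 by [].
by rewrite dicksonE ?mulr1 // !expr1n.
Qed.

(** The sum is that of w^i for i from -h to h, a full period. *)
Lemma sum_unity_root (R : idomainType) (w w' : R) h :
  w * w' = 1 -> w ^+ h.*2.+1 = 1 -> w != 1 ->
  1 + \sum_(j < h) (w ^+ j.+1 + w' ^+ j.+1) = 0.
Proof.
move=> ww' wN w1; apply: (@mulfI _ (w - 1)); first by rewrite subr_eq0.
have -> : (w - 1) * (1 + \sum_(j < h) (w ^+ j.+1 + w' ^+ j.+1)) =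
          w ^+ h.+1 - w' ^+ h.
  elim: h {wN} => [|h IH]; first by rewrite big_ord0 !expr0 expr1 addr0 mulr1.
  rewrite big_ord_recr /= addrA mulrDr IH !exprS; ring: ww'.
rewrite mulr0; apply/eqP; rewrite subr_eq0; apply/eqP.
have whh : w ^+ h * w' ^+ h = 1 by rewrite -exprMn ww' expr1n.
rewrite -[LHS]mulr1 -whh mulrA -exprD (_ : (h.+1 + h)%N = h.*2.+1) ?wN ?mul1r //.
by rewrite -addnn.
Qed.

Lemma dicksonX_monic (R : comNzRingType) k :
  size (dickson ('X : {poly R}) k.+1) = k.+2 /\
  dickson ('X : {poly R}) k.+1 \is monic.
Proof.
elim/nat_ind2: k => [||k [s1 m1] [s2 m2]].
- by rewrite /dickson /= size_polyX monicX.
- rewrite /dickson linrecSS /=; have s : (size (- (2 : {poly R}))%R < size (('X : {poly R}) * 'X)%R)%N.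
    rewrite size_polyN -expr2 size_polyXn.
    have -> : (2 : {poly R}) = 2%:P by rewrite rmorph_nat.
    by apply: leq_ltn_trans (size_polyC_leq1 _) _.
  by rewrite monicE lead_coefDl // size_polyDl // -expr2 size_polyXn lead_coefXn eqxx.
rewrite /dickson linrecSS -!/(dickson _ _).
have sX : size ('X * dickson ('X : {poly R}) k.+2) = k.+4.
  by rewrite mulrC size_mulX ?s2 // monic_neq0.
have s : (size (- dickson ('X : {poly R}) k.+1)%R < size ('X * dickson ('X : {poly R}) k.+2)%R)%N.
  by rewrite sX size_polyN s1.
by rewrite monicE lead_coefDl // size_polyDl // -monicE monicMr // monicX.
Qed.
(** * The minimal polynomial of z + z^-1 *)

(** With q = p^(r-1) and m = (p-1)/2, this is the cyclotomic polynomial of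
    order p^r in the variable y, divided by y^(q m) and written in terms of
    y + y^-1. *)
Definition psi (R : comNzRingType) (q m : nat) : {poly R} :=
  1 + \sum_(i < m) dickson 'X (q * i.+1).

Lemma psi_monic (R : comNzRingType) q m : (0 < q)%N ->
  size (psi R q m) = (q * m).+1 /\ psi R q m \is monic.
Proof.
move=> q_gt0; elim: m => [|m [sm mm]].
  by rewrite /psi big_ord0 addr0 muln0 size_poly1 monic1.
rewrite /psi big_ord_recr /= addrA -/(psi R q m) [_ + dickson _ _]addrC.
have /prednK E : (0 < q * m.+1)%N by rewrite muln_gt0 q_gt0.
have [s1 m1] := dicksonX_monic R (q * m.+1).-1; rewrite E in s1 m1.
have lt : (size (psi R q m) < size (dickson ('X : {poly R}) (q * m.+1)))%N.
  by rewrite s1 sm ltnS ltn_pmul2l.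
by rewrite monicE lead_coefDl // size_polyDl // s1.
Qed.

Lemma map_psi (R S : comNzRingType) (g : {rmorphism R -> S}) q m :
  map_poly g (psi R q m) = psi S q m.
Proof.
rewrite /psi rmorphD rmorph1 rmorph_sum; congr (_ + _).
by apply: eq_bigr => i _; rewrite rmorph_dickson /= map_polyX.
Qed.

Lemma psi_horner (R : comNzRingType) q m (x : R) :
  (psi R q m).[x] = 1 + \sum_(i < m) dickson x (q * i.+1).
Proof.
rewrite -/(horner_eval x _) rmorphD rmorph1 rmorph_sum; congr (_ + _).
by apply: eq_bigr => i _; rewrite rmorph_dickson /= /horner_eval hornerX.
Qed.

Lemma psi_horner2 (R : comNzRingType) q m : (psi R q m).[2] = (m.*2.+1)%:R.
Proof.
rewrite psi_horner (eq_bigr (fun=> 2)) => [|i _]; last exact: dickson2.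
by rewrite sumr_const card_ord -(natr1 m.*2) addrC -muln2 natrM mulr_natl.
Qed.

(** With w = y^q, the value is the sum of w^i for i from -m to m. *)
Lemma psi_root (R : idomainType) q m (y y' : R) :
  y * y' = 1 -> y ^+ (q * m.*2.+1) = 1 -> y ^+ q != 1 -> root (psi R q m) (y + y').
Proof.
move=> yy' yN yq; apply/eqP; rewrite psi_horner.
under eq_bigr => i _ do rewrite dicksonE // !exprM.
apply: sum_unity_root => //; first by rewrite -exprMn yy' expr1n.
by rewrite -exprM.
Qed.

(** This keeps the real conjugates of z + z^-1 below 2: their Dickson values
    are periodic. *)
Lemma dickson_growth (R : realFieldType) (x : R) : 2 < x ->
  forall k, 2 <= dickson x k /\ dickson x k < dickson x k.+1.
Proof.
move=> x2; elim=> [|k [IH1 IH2]]; first by split; rewrite /dickson /= ?lexx.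
have d2 : 2 < dickson x k.+1 by apply: le_lt_trans IH2.
split; first exact: ltW.
rewrite [ltRHS]linrecSS -/(dickson x k) -/(dickson x k.+1).
have : 0 < (x - 2) * (dickson x k.+1 - 2) by rewrite mulr_gt0 ?subr_gt0.
move: (dickson x k) (dickson x k.+1) IH1 IH2 d2 => a b *; nra.
Qed.

(** * Total ramification of p *)
Section RealCyclotomic.

Variables (p r : nat) (p_prime : prime p) (p_odd : odd p) (r_gt0 : (0 < r)%N).
Variables (L K : fieldExtType rat) (z : L) (f : {rmorphism K -> L}) (t : K).
Hypothesis z_prim : (p ^ r)%N.-primitive_root z.
Hypothesis ft : f t = z + z^-1.
Hypothesis gen : forall x : K, exists P : {poly rat}, x = (map_poly (in_alg K) P).[t].

(** [H] lists one representative of each class of units of Z/N up to sign.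
    The element t' is the conjugate y + y^-1 of t with y^2 = z, so that
    lam = -(y - y^-1)^2. *)
Let N := (p ^ r)%N.
Let h := N./2.
Let q := (p ^ r.-1)%N.
Let n := (q * p./2)%N.
Let H := [seq k <- iota 1 h | ~~ (p %| k)%N].
Let c k : K := dickson t k.
Let lam := 2 - t.
Let t' := c h.+1.
Let u k := dicksonU t' k.

Lemma N_doubleS : N = h.*2.+1.
Proof. by rewrite -[LHS]odd_double_half oddX p_odd orbT. Qed.

Lemma p_doubleS : p = p./2.*2.+1.
Proof. by rewrite -[LHS]odd_double_half p_odd. Qed.

Lemma N_qp : N = (q * p)%N.
Proof. by rewrite /N -(prednK r_gt0) expnSr. Qed.

Lemma q_gt0 : (0 < q)%N.
Proof. by rewrite expn_gt0 prime_gt0. Qed.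

(** Among 1, ..., h there are q/2 (rounded down) multiples of p. *)
Lemma size_H : size H = n.
Proof.
have qo : odd q by rewrite oddX p_odd orbT.
have p2 := prime_gt1 p_prime.
have hE : h = (q * p./2 + q./2)%N.
  apply: double_inj; apply: succn_inj; rewrite -N_doubleS N_qp {1}p_doubleS.
  have := odd_double_half q; rewrite qo; nia.
have cnt : count (fun k => p %| k)%N (iota 1 h) = q./2.
  rewrite -sum1_count big_mkcond /=; transitivity (h %/ p)%N.
    rewrite divn_count_dvd /index_iota subSS subn0; apply: eq_bigr => i _.
    by case: (p %| i)%N.
  have -> : h = (q./2 * p + p./2)%N.
    have := odd_double_half q; rewrite qo; have := p_doubleS; nia.
  rewrite divnMDl ?prime_gt0 // divn_small ?addn0 //; have := p_doubleS; lia.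
have := count_predC (fun k => p %| k)%N (iota 1 h).
rewrite size_filter cnt size_iota {2}hE addnC => /addIn.
by apply.
Qed.

Lemma z_unit : z != 0.
Proof.
by apply/eqP=> z0; have /eqP := prim_expr_order z_prim; rewrite z0 expr0n gtn_eqF ?expn_gt0 ?prime_gt0 // eq_sym oner_eq0.
Qed.

Lemma zzV : z * z^-1 = 1.
Proof. by rewrite mulfV ?z_unit. Qed.

Lemma fcE k : f (c k) = z ^+ k + z^-1 ^+ k.
Proof. by rewrite rmorph_dickson ft dicksonE ?zzV. Qed.

Lemma memH k : k \in H -> [/\ (0 < k)%N, (k <= h)%N & ~~ (p %| k)%N].
Proof. by rewrite mem_filter mem_iota add1n ltnS => /and3P[-> -> ->]. Qed.

Lemma half_root : exists y, [/\ y * y^-1 = 1, y ^+ 2 = z, f t' = y + y^-1,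
  y - y^-1 != 0 & y ^+ N = 1].
Proof.
have yV : z ^+ h.+1 * (z ^+ h.+1)^-1 = 1 by rewrite mulfV ?expf_neq0 ?z_unit.
have y2 : (z ^+ h.+1) ^+ 2 = z.
  by rewrite -exprM muln2 doubleS exprS -N_doubleS (prim_expr_order z_prim) mulr1.
exists (z ^+ h.+1); split => //.
- by rewrite fcE exprVn.
- rewrite subr_eq0; apply/eqP=> yy.
  have : (z ^+ h.+1) ^+ 2 = 1 by rewrite expr2 {2}yy yV.
  rewrite y2 => z1; have := prim_order_dvd z_prim 1.
  rewrite z1 expr1n eqxx => /dvdn_leq => /(_ isT).
  rewrite leqNgt -/N N_qp; have := q_gt0; have := prime_gt1 p_prime; nia.
- by rewrite -exprM mulnC exprM (prim_expr_order z_prim) expr1n.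
Qed.

(** Both 2 - z^k - z^-k = -(y^k - y^-k)^2 and lam = -(y - y^-1)^2. *)
Lemma sub2c k : 2 - c k = lam * u k ^+ 2.
Proof.
have [y [yyV y2 fy _ _]] := half_root.
apply: (fmorph_inj f).
rewrite rmorphM rmorphXn !rmorphB rmorph_nat ft fcE rmorph_dicksonU fy.
have := dicksonUE k yyV; set U := dicksonU _ _ => E.
rewrite -y2 -exprVn.
have -> : 2 - (y ^+ 2 + y^-1 ^+ 2) = - (y - y^-1) ^+ 2.
  by move: (y^-1) yyV => y' yy'; ring: yy'.
rewrite mulNr -exprMn E -!exprM !(mulnC 2) !exprM.
have : y ^+ k * y^-1 ^+ k = 1 by rewrite -exprMn yyV expr1n.
by move: (y ^+ k) (y^-1 ^+ k) => a b ab; ring: ab.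
Qed.

(** The inverse (y - y^-1)/(y^k - y^-k) is of the same shape with base y^k,
    since y is the k'-th power of y^k for an inverse k' of k modulo N. *)
Lemma u_unit k : ~~ (p %| k)%N -> exists k', u k * dicksonU (dickson t' k) k' = 1.
Proof.
move=> pk; have co : coprime k N by rewrite coprime_sym coprimeXl // prime_coprime.
have k_gt0 : (0 < k)%N by case: k pk {co}; rewrite ?dvdn0.
have [k' k'' E _] := egcdnP N k_gt0; rewrite (eqP co) in E.
have [y [yyV y2 fy yB yN]] := half_root.
exists k'; apply: (fmorph_inj f); apply: (mulfI yB).
rewrite rmorphM rmorph1 !rmorph_dicksonU (rmorph_dickson f t' k) fy mulrA dicksonUE ?yyV //.
rewrite dicksonE ?yyV // dicksonUE -?exprMn ?yyV ?expr1n // -!exprM mulnC E mulr1.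
by rewrite !exprD !(mulnC k'') !exprM exprVn yN invr1 !expr1n !mul1r !expr1.
Qed.

Lemma c_inj i j : (0 < i <= h)%N -> (0 < j <= h)%N -> c i = c j -> i = j.
Proof.
move=> /andP[i0 ih] /andP[j0 jh] /(congr1 f); rewrite !fcE.
have ai : z ^+ i * z^-1 ^+ i = 1 by rewrite -exprMn zzV expr1n.
have aj : z ^+ j * z^-1 ^+ j = 1 by rewrite -exprMn zzV expr1n.
move=> E; have /eqP : (z ^+ i - z ^+ j) * (z ^+ i * z ^+ j - 1) = 0.
  have E' : z^-1 ^+ j = z ^+ i + z^-1 ^+ i - z ^+ j by rewrite E addrAC subrr add0r.
  move: ai aj; rewrite E'; move: (z ^+ i) (z ^+ j) (z^-1 ^+ i) => a b a' aa' bb'.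
  (* With b' = a + a' - b, this is a combination of a a' - 1 and b b' - 1. *)
  have -> : (a - b) * (a * b - 1) = a * (b * (a + a' - b) - 1) + b * (1 - a * a') by ring.
  by rewrite aa' bb' !subrr !mulr0 addr0.
rewrite mulf_eq0 !subr_eq0 => /orP[|].
  have small x : (x <= h)%N -> (x %% N = x)%N by move=> xh; rewrite modn_small // N_doubleS; lia.
  by rewrite (eq_prim_root_expr z_prim) -/N !small // => /eqP.
rewrite -exprD -(prim_order_dvd z_prim) => /dvdn_leq; rewrite -/N N_doubleS; lia.
Qed.

Lemma psi_root_c k : ~~ (p %| k)%N -> root (psi K q p./2) (c k).
Proof.
move=> pk; rewrite -(fmorph_root f) map_psi fcE; apply: psi_root.
- by rewrite -exprMn zzV expr1n.
- by rewrite -p_doubleS -N_qp -exprM mulnC exprM (prim_expr_order z_prim) expr1n.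
- by rewrite -exprM -(prim_order_dvd z_prim) -/N N_qp mulnC dvdn_pmul2r ?q_gt0.
Qed.

Lemma uniq_cH : uniq [seq c k | k <- H].
Proof.
rewrite map_inj_in_uniq ?filter_uniq ?iota_uniq // => i j.
by move=> /memH[i0 ih _] /memH[j0 jh _]; apply: c_inj; rewrite ?i0 ?j0.
Qed.

Lemma psi_prod : psi K q p./2 = \prod_(k <- H) ('X - (c k)%:P).
Proof.
have [s m] := psi_monic K p./2 q_gt0.
rewrite [LHS](@all_roots_prod_XsubC _ _ [seq c k | k <- H]) ?big_map.
- by rewrite (eqP m) scale1r.
- by rewrite size_map size_H.
- by apply/allP=> _ /mapP[k /memH[_ _ pk] ->]; apply: psi_root_c.
- by rewrite uniq_rootsE uniq_cH.
Qed.

Let w := \prod_(k <- H) u k.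

(** Evaluate [psi_prod] at 2, where [psi] takes the value p. *)
Lemma p_lam : p%:R = lam ^+ n * w ^+ 2.
Proof.
rewrite [in LHS]p_doubleS -(psi_horner2 K q) psi_prod horner_prod -size_H /w -prodrXl.
under eq_bigr => k _ do rewrite hornerXsubC sub2c.
rewrite big_split /=; congr (_ * _).
by rewrite big_const_seq count_predT -Monoid.iteropE.
Qed.

(** * Integers of K and the order Z[t] *)
Lemma integral_rat_int (x : rat) :
  integralOver (intr : int -> K) (x%:A) -> x \is a Num.int.
Proof.
case=> P Pmon; rewrite -(eq_map_poly (rmorph_int (in_alg K))).
rewrite (map_poly_comp (in_alg K) intr) fmorph_root -(fmorph_root (ratr : rat -> algC)).
rewrite -map_poly_comp => rP.
have : (ratr x : algC) \in Aint.
  apply: root_monic_Aint rP _ _; first exact: monic_map.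
  by apply/polyOverP=> i; rewrite coef_map /= ratr_int.
move=> /(Cint_rat_Aint (Crat_rat x)) /intrP[m E].
have -> : x = m%:~R; last exact: intr_int.
by apply: (fmorph_inj (ratr : rat -> algC)); rewrite /= rmorph_int; exact: E.
Qed.

Let O := ring_of_integers (K:=K).

Lemma O_int (m : int) : O m%:~R.
Proof. exact: (integral_id (intr : int -> K)). Qed.

Lemma O_add x y : O x -> O y -> O (x + y).
Proof. exact: (@integral_add _ _ (intr : int -> K)). Qed.

Lemma O_mul x y : O x -> O y -> O (x * y).
Proof. exact: (@integral_mul _ _ (intr : int -> K)). Qed.

Lemma O_opp x : O x -> O (- x).
Proof. exact: (@integral_opp _ _ (intr : int -> K)). Qed.

Lemma O_exp x k : O x -> O (x ^+ k).
Proof.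
by move=> Ox; elim: k => [|k IH]; rewrite ?exprS; [exact: (O_int 1)|exact: O_mul].
Qed.

Definition in_Zt x := exists P : {poly int}, x = (map_poly intr P).[t].

Lemma Zt_int (m : int) : in_Zt m%:~R.
Proof. by exists m%:P; rewrite map_polyC hornerC. Qed.

Lemma Zt_t : in_Zt t.
Proof. by exists 'X; rewrite map_polyX hornerX. Qed.

Lemma Zt_add x y : in_Zt x -> in_Zt y -> in_Zt (x + y).
Proof. by move=> [P ->] [Q ->]; exists (P + Q); rewrite rmorphD hornerD. Qed.

Lemma Zt_opp x : in_Zt x -> in_Zt (- x).
Proof. by move=> [P ->]; exists (- P); rewrite rmorphN hornerN. Qed.

Lemma Zt_mul x y : in_Zt x -> in_Zt y -> in_Zt (x * y).
Proof. by move=> [P ->] [Q ->]; exists (P * Q); rewrite rmorphM hornerM. Qed.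

Lemma Zt_exp x k : in_Zt x -> in_Zt (x ^+ k).
Proof.
by move=> Ax; elim: k => [|k IH]; rewrite ?exprS; [exact: (Zt_int 1)|exact: Zt_mul].
Qed.

Lemma Zt_linrec a b x k : in_Zt a -> in_Zt b -> in_Zt x -> in_Zt (linrec a b x k).
Proof.
move=> Aa Ab Ax; elim: k a b Aa Ab => //= k IH a b Aa Ab; apply: IH => //.
by apply: Zt_add (Zt_mul _ _) (Zt_opp _).
Qed.

Lemma Zt_dickson x k : in_Zt x -> in_Zt (dickson x k).
Proof. by move=> Ax; apply: Zt_linrec => //; apply: (Zt_int 2). Qed.

Lemma Zt_dicksonU x k : in_Zt x -> in_Zt (dicksonU x k).
Proof. by move=> Ax; apply: Zt_linrec => //; [apply: (Zt_int 0)|apply: (Zt_int 1)]. Qed.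

Lemma Zt_t' : in_Zt t'. Proof. exact: Zt_dickson Zt_t. Qed.

Lemma Zt_lam : in_Zt lam.
Proof. exact: Zt_add (Zt_int 2) (Zt_opp Zt_t). Qed.

Lemma O_t : O t.
Proof.
have [_ m] := psi_monic int p./2 q_gt0.
exists (psi int q p./2) => //; rewrite map_psi; apply: (@psi_root_c 1).
by rewrite Euclid_dvd1.
Qed.

Lemma Zt_O x : in_Zt x -> O x.
Proof.
case=> P ->; elim/poly_ind: P => [|P m IH]; first by rewrite rmorph0 horner0; apply: (O_int 0).
rewrite rmorphD rmorphM /= map_polyX map_polyC hornerMXaddC.
by apply: O_add (O_int m); apply: O_mul O_t.
Qed.

Lemma w_unit : exists2 v, in_Zt v & w * v = 1.
Proof.
rewrite /w; have : all (fun k => ~~ (p %| k)%N) H by apply/allP=> k /memH[].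
elim: H => [_|k s IH /= /andP[pk /IH[v Av E]]].
  by exists 1; [apply: (Zt_int 1)|rewrite big_nil mulr1].
have [k' E'] := u_unit pk; exists (dicksonU (dickson t' k) k' * v).
  by apply: Zt_mul => //; apply/Zt_dicksonU/Zt_dickson/Zt_t'.
by rewrite big_cons mulrACA E E' mulr1.
Qed.

Lemma Zt_w : in_Zt w.
Proof.
by rewrite /w; elim/big_ind: _ => [|a b|k _]; [exact: (Zt_int 1)|exact: Zt_mul|apply/Zt_dicksonU/Zt_t'].
Qed.

Lemma n_gt0 : (0 < n)%N.
Proof. by rewrite muln_gt0 q_gt0; have := p_doubleS; have := prime_gt1 p_prime; lia. Qed.

Lemma natrK_neq0 k : (0 < k)%N -> (k%:R : K) != 0.
Proof. by move=> k0; rewrite -(rmorph_nat (in_alg K)) fmorph_eq0 pnatr_eq0 -lt0n. Qed.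

Lemma lam_neq0 : lam != 0.
Proof.
apply/eqP=> l0; have := natrK_neq0 (prime_gt0 p_prime).
by rewrite p_lam l0 expr0n gtn_eqF ?n_gt0 // mul0r eqxx.
Qed.

(** From p = lam^n w^2, the n-th power of m is p times an integer of K. *)
Lemma p_dvd_lam (m : int) x : O x -> m%:~R = lam * x -> (p %| m)%Z.
Proof.
move=> Ox E; have [v Av wv] := w_unit.
have E1 : (m ^+ n)%:~R = p%:R * (x ^+ n * v ^+ 2).
  rewrite p_lam rmorphXn /= E exprMn.
  move: (lam ^+ n) (x ^+ n) => a b.
  by move: wv; move: w v {Av} => w0 v0 wv; ring: wv.
have p0 : p%:R != 0 :> rat by rewrite pnatr_eq0 -lt0n prime_gt0.
have : ((m ^+ n)%:~R / p%:R : rat) \is a Num.int.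
  apply: integral_rat_int.
  have -> : ((m ^+ n)%:~R / p%:R : rat)%:A = x ^+ n * v ^+ 2 :> K.
    rewrite -[LHS]/(in_alg K _) fmorph_div rmorph_int rmorph_nat E1 mulrC mulKf //.
    exact/natrK_neq0/prime_gt0.
  by apply: O_mul; apply: O_exp => //; apply: Zt_O.
move/intrP=> [a Ea]; have : (p %| (m ^+ n)%R)%Z.
  apply/dvdzP; exists a; apply: (@intr_inj rat); rewrite rmorphM /= -Ea -pmulrn.
  by rewrite divfK.
by rewrite !dvdzE abszX /= Euclid_dvdX // => /andP[].
Qed.

(** The residue ring Z[t]/lam is a quotient of Z because t is 2 modulo lam. *)
Lemma Zt_decomp x : in_Zt x -> exists (m : int) (a : K), in_Zt a /\ x = m%:~R + lam * a.
Proof.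
move=> [P ->]; have /factor_theorem[Q E] : root (P - (P.[2])%:P) 2.
  by rewrite rootE hornerD hornerN hornerC subrr.
exists P.[2], (- (map_poly intr Q).[t]); split.
  by apply: Zt_opp; exists Q.
rewrite -[P in LHS](subrK (P.[2])%:P) E rmorphD rmorphM /= rmorphB /= map_polyX !map_polyC.
by rewrite !hornerE /lam /=; ring.
Qed.

(** Modulo lam, an element of lam O in Z[t] is a rational integer divisible by
    p, and p itself is in lam Z[t]: Z[t] is maximal at lam. *)
Lemma Zt_divlam x : O x -> in_Zt (lam * x) -> in_Zt x.
Proof.
move=> Ox /Zt_decomp[m [a [Aa E]]].
have /(p_dvd_lam _)/dvdzP[]: m%:~R = lam * (x - a) by rewrite mulrBr E addrK.
  by apply: O_add Ox _; apply/O_opp/Zt_O.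
move=> m' Em; have -> : x = a + lam ^+ n.-1 * w ^+ 2 * m'%:~R.
  apply: (mulfI lam_neq0); rewrite E Em rmorphM /= -pmulrn p_lam -(prednK n_gt0) exprS /=.
  ring.
by apply: Zt_add Aa _; apply: Zt_mul (Zt_int _); apply: Zt_mul; apply: Zt_exp; [exact: Zt_lam|exact: Zt_w].
Qed.

Lemma Zt_divlamX x k : O x -> in_Zt (lam ^+ k * x) -> in_Zt x.
Proof.
move=> Ox; elim: k => [|k IH]; first by rewrite mul1r.
rewrite exprS -mulrA => /Zt_divlam-A1; apply/IH/A1.
by apply: O_mul Ox; apply/O_exp/Zt_O/Zt_lam.
Qed.

Lemma Zt_divNat x k : O x -> in_Zt ((p ^ k)%:R * x) -> in_Zt x.
Proof.
move=> Ox; rewrite natrX p_lam exprMn => Ax; have [v Av wv] := w_unit.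
apply: (@Zt_divlamX _ (n * k)) => //; rewrite exprM.
have -> : lam ^+ n ^+ k * x = (v ^+ 2) ^+ k * ((lam ^+ n) ^+ k * (w ^+ 2) ^+ k * x).
  have : (v ^+ 2) ^+ k * (w ^+ 2) ^+ k = 1.
    by rewrite -exprMn -exprMn [v * w]mulrC wv !expr1n.
  move: (lam ^+ n ^+ k) ((v ^+ 2) ^+ k) ((w ^+ 2) ^+ k) => a b d bd; ring: bd.
by apply: Zt_mul => //; do 2!apply: Zt_exp.
Qed.

(** Eisenstein's criterion in the form of a divisibility of coefficients: the
    constant term is divisible by lam, hence by p, hence by lam^n; it can then
    be dropped and the equation divided by lam. *)
Lemma eisenstein_step e (Q : {poly int}) a : (e <= n)%N -> in_Zt a ->
  (map_poly intr Q).[lam] = lam ^+ e * a -> forall i, (i < e)%N -> (p %| Q`_i)%Z.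
Proof.
elim: e Q a => // e IH Q a en Aa.
elim/poly_ind: Q => [_ i _|Q m _]; first by rewrite coef0 dvdz0.
have AQ : in_Zt (map_poly intr Q).[lam].
  elim/poly_ind: Q => [|Q b IHQ]; first by rewrite rmorph0 horner0; apply: (Zt_int 0).
  rewrite rmorphD rmorphM /= map_polyX map_polyC hornerMXaddC.
  by apply: Zt_add (Zt_int _); apply: Zt_mul Zt_lam.
rewrite rmorphD rmorphM /= map_polyX map_polyC hornerMXaddC => E.
have /(p_dvd_lam _)pm : m%:~R = lam * (lam ^+ e * a - (map_poly intr Q).[lam]).
  by rewrite mulrBr mulrA -exprS -E; ring.
have {}pm : (p %| m)%Z.
  apply: pm; apply/Zt_O/Zt_add; last exact: Zt_opp.
  by apply: Zt_mul Aa; apply/Zt_exp/Zt_lam.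
have [m' Em] := dvdzP pm.
case=> [|i] ie; rewrite coefD coefMX coefC /= ?add0r // addr0.
apply: (IH Q (a - lam ^+ (n - e.+1) * w ^+ 2 * m'%:~R)) ie; first exact: ltnW.
  apply: Zt_add Aa _; apply: Zt_opp; apply: Zt_mul (Zt_int _).
  by apply: Zt_mul; apply: Zt_exp; [exact: Zt_lam|exact: Zt_w].
apply: (mulfI lam_neq0); rewrite [LHS]mulrC -[LHS](addrK m%:~R) E Em rmorphM /= -pmulrn p_lam.
by rewrite mulrBr mulrBr !mulrA -exprS -exprD subnKC //; ring.
Qed.

(** Rewritten in lam = 2 - t and made primitive over Z, a relation of degree
    less than n would have all its coefficients divisible by p. *)
Lemma t_free (Q : {poly rat}) : (size Q <= n)%N -> (map_poly (in_alg K) Q).[t] = 0 -> Q = 0.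
Proof.
pose Q' := Q \Po (2 - 'X).
have s2 : size (2 - 'X : {poly rat}) = 2.
  by rewrite -opprB size_polyN -[2]/(2%:R) -polyC_natr size_XsubC.
move=> sQ Q0; apply/eqP; rewrite -(@comp_poly2_eq0 _ Q (2 - 'X)) // -/Q'.
have sQ' : (size Q' <= n)%N.
  by rewrite /Q' size_comp_poly2.
have {Q0} Q'0 : (map_poly (in_alg K) Q').[lam] = 0.
  rewrite map_comp_poly rmorphB /= map_polyX rmorph_nat horner_comp !hornerE /lam.
  by rewrite -[1 + 1]/(2 : K) opprB addrC subrK.
have [P [d d0 E]] := rat_poly_scale Q'; move: sQ' Q'0; rewrite E.
have d0' : (d%:~R^-1 : rat) != 0 by rewrite invr_eq0 intr_eq0.
rewrite size_scale // size_map_inj_poly //; last exact: intr_inj.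
rewrite linearZ /= hornerZ -map_poly_comp (eq_map_poly (rmorph_int (in_alg K))) => sP.
move/eqP; rewrite mulf_eq0 -[_%:A]/(in_alg K _) fmorph_eq0 (negPf d0') /= => /eqP P0.
rewrite scaler_eq0 (negPf d0') /=; apply/negPn/negP => Pn0.
have Pnz : P != 0 by apply: contraNneq Pn0 => ->; rewrite rmorph0.
have : (p %| zcontents (zprimitive P))%Z.
  rewrite dvdz_contents; apply/polyOverP => i.
  case: (ltnP i n) => [i_n|ni]; last first.
    by rewrite nth_default ?rpred0 // size_zprimitive (leq_trans sP).
  apply: (@eisenstein_step n _ 0) i_n => //; first exact: (Zt_int 0).
  rewrite mulr0; have := P0; rewrite {1}(zpolyEprim P) linearZ /= hornerZ => /eqP.
  rewrite mulf_eq0 => /orP[|/eqP //]; rewrite -[_ == 0]/(_ == 0).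
  rewrite -(rmorph_int (in_alg K)) fmorph_eq0 intr_eq0 zcontents_eq0 => /eqP P0'.
  by rewrite P0' eqxx in Pnz.
by rewrite zcontents_primitive Pnz dvdzE /= Euclid_dvd1.
Qed.

(** * Conjugates and the trace *)
Lemma c1 : c 1 = t. Proof. by []. Qed.

Lemma psi_root_t : root (psi K q p./2) t.
Proof. by rewrite -c1 psi_root_c // Euclid_dvd1. Qed.

Lemma psi_dvd (P : {poly rat}) : (map_poly (in_alg K) P).[t] = 0 -> psi rat q p./2 %| P.
Proof.
move=> P0; have [sp mp] := psi_monic rat p./2 q_gt0.
rewrite /dvdp; apply/eqP/t_free.
  by rewrite -ltnS -sp ltn_modp monic_neq0.
have := P0; rewrite {1}(divp_eq P (psi rat q p./2)) rmorphD rmorphM /= map_psi hornerD hornerM.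
by rewrite (rootP psi_root_t) mulr0 add0r.
Qed.

Lemma poly_agree (P Q : {poly rat}) d : root (psi K q p./2) d ->
  (map_poly (in_alg K) P).[t] = (map_poly (in_alg K) Q).[t] ->
  (map_poly (in_alg K) P).[d] = (map_poly (in_alg K) Q).[d].
Proof.
move=> rd E; have : psi rat q p./2 %| P - Q.
  by apply: psi_dvd; rewrite rmorphB hornerD hornerN E subrr.
case/dvdpP=> S ES; rewrite -(subrK Q P) ES rmorphD rmorphM /= map_psi hornerD hornerM.
by rewrite (rootP rd) mulr0 add0r.
Qed.

Lemma dim_K : \dim {:K} = n.
Proof.
pose X : n.-tuple K := [tuple t ^+ i | i < n].
have XE (i : 'I_n) : X`_i = t ^+ i by rewrite -tnth_nth tnth_mktuple.
have eval (P : {poly rat}) : (size P <= n)%N ->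
    (map_poly (in_alg K) P).[t] = \sum_(i < n) P`_i *: X`_i.
  move=> sP; rewrite (@horner_coef_wide _ n) ?size_map_poly //.
  by apply: eq_bigr => i _; rewrite coef_map /= mulr_algl XE.
suff BX : basis_of {:K} X by rewrite (size_basis BX).
rewrite basisEdim; apply/andP; split; last first.
  have /eqP <- : free X.
    apply/freeP => k E i; have : rVpoly (\row_i k i) = 0.
      apply: t_free; rewrite ?size_poly // eval ?size_poly // -[RHS]E.
      by apply: eq_bigr => j _; rewrite coef_rVpoly_ord mxE.
    by move/(congr1 (fun P : {poly rat} => P`_i)); rewrite coef_rVpoly_ord mxE coef0.
  by rewrite dimvS ?subvf.
apply/subvP => x _; have [P ->] := gen x.
have [sp mp] := psi_monic rat p./2 q_gt0.
rewrite (divp_eq P (psi rat q p./2)) rmorphD rmorphM /= map_psi hornerD hornerM.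
rewrite (rootP psi_root_t) mulr0 add0r eval; last by rewrite -ltnS -sp ltn_modp monic_neq0.
by apply: memv_suml => i _; rewrite memvZ // memv_span // mem_nth ?size_tuple.
Qed.

Let gen_bool x : exists P : {poly rat}, x == (map_poly (in_alg K) P).[t].
Proof. by have [P ->] := gen x; exists P. Qed.

Definition polyof x := xchoose (gen_bool x).

Lemma polyofK x : (map_poly (in_alg K) (polyof x)).[t] = x.
Proof. by rewrite -(eqP (xchooseP (gen_bool x))). Qed.

(** The automorphism sending t to z^k + z^-k.  The value t when p divides k
    makes this a ring morphism for every k, so that the structure can be
    attached to it unconditionally. *)
Definition galconj k x := (map_poly (in_alg K) (polyof x)).[if (p %| k)%N then t else c k].

Lemma galconj_root k : root (psi K q p./2) (if (p %| k)%N then t else c k).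
Proof. by case: ifPn => pk; [exact: psi_root_t|exact: psi_root_c]. Qed.

Lemma galconjE k (P : {poly rat}) : 
  galconj k (map_poly (in_alg K) P).[t] = (map_poly (in_alg K) P).[if (p %| k)%N then t else c k].
Proof. by apply: poly_agree; [exact: galconj_root|exact: polyofK]. Qed.

Lemma galconj_zmod k : zmod_morphism (galconj k).
Proof.
move=> x y; rewrite -[x in LHS]polyofK -[y in LHS]polyofK -hornerN -hornerD -rmorphN -rmorphD galconjE.
by rewrite rmorphD rmorphN hornerD hornerN.
Qed.

Lemma galconj_monoid k : monoid_morphism (galconj k).
Proof.
split=> [|x y].
  by have := galconjE k 1; rewrite rmorph1 !hornerC.
rewrite -[x in LHS]polyofK -[y in LHS]polyofK -hornerM -rmorphM galconjE.
by rewrite rmorphM hornerM.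
Qed.

HB.instance Definition _ k := GRing.isZmodMorphism.Build K K (galconj k) (galconj_zmod k).
HB.instance Definition _ k := GRing.isMonoidMorphism.Build K K (galconj k) (galconj_monoid k).

Lemma galconj_t k : ~~ (p %| k)%N -> galconj k t = c k.
Proof.
move=> /negPf pk; have {1}-> : t = (map_poly (in_alg K) 'X).[t] by rewrite map_polyX hornerX.
by rewrite galconjE pk map_polyX hornerX.
Qed.

Lemma galconj_alg k (a : rat) : galconj k a%:A = a%:A.
Proof.
by have := galconjE k a%:P; rewrite map_polyC !hornerC.
Qed.

Lemma galconj_c k j : ~~ (p %| k)%N -> galconj k (c j) = c (k * j).
Proof.
move=> pk; rewrite rmorph_dickson /= galconj_t //; apply: (fmorph_inj f).
by rewrite rmorph_dickson !fcE dicksonE ?exprM // -exprMn zzV expr1n.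
Qed.

Lemma galconj_O k x : O x -> O (galconj k x).
Proof.
move=> [P Pm rP]; exists P => //; rewrite -(fmorph_root (galconj k)) in rP.
move: rP; rewrite -map_poly_comp; rewrite (@eq_map_poly _ _ _ intr) // => m.
exact: (rmorph_int (galconj k)).
Qed.

(** The matrix W of the conjugates of a basis diagonalizes multiplication by x,
    and W is invertible because a change of basis turns it into the Vandermonde
    matrix of the distinct conjugates of t. *)
Lemma field_traceE x : (field_trace x)%:A = \sum_(k <- H) galconj k x.
Proof.
rewrite /field_trace; set b := vbasis {:K}; set M := \matrix_(i, j) _.
pose k_ (j : 'I_(\dim {:K})) := nth 0%N H j.
have sH : size H = \dim {:K} by rewrite size_H dim_K.
have k_H j : k_ j \in H by rewrite mem_nth ?sH.
have bE y : y = \sum_j coord b j y *: b`_j by apply: coord_basis (vbasisP _) (memvf _).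
have conjZ k (a : rat) y : galconj k (a *: y) = a%:A * galconj k y.
  by rewrite -mulr_algl rmorphM /= galconj_alg.
pose W := \matrix_(i < \dim {:K}, j < \dim {:K}) galconj (k_ j) b`_i.
pose D := \row_(j < \dim {:K}) galconj (k_ j) x.
have MW : map_mx (in_alg K) M *m W = W *m diag_mx D.
  rewrite mul_mx_diag; apply/matrixP => i j; rewrite !mxE -rmorphM /= mulrC [in RHS](bE (x * _)).
  by rewrite raddf_sum; apply: eq_bigr => l _; rewrite /= !mxE conjZ.
have uW : W \in unitmx.
  pose E := \matrix_(i < \dim {:K}, j < \dim {:K}) ((coord b j (t ^+ i))%:A : K).
  have EW : E *m W = Vandermonde (\dim {:K}) (\row_j c (k_ j)).
    apply/matrixP => i j; rewrite !mxE -(@galconj_t (k_ j)); last by have [] := memH (k_H j).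
    rewrite -rmorphXn /= [in RHS](bE (t ^+ i)) raddf_sum.
    by apply: eq_bigr => l _; rewrite /= !mxE conjZ.
  have := congr1 determinant EW; rewrite det_mulmx det_Vandermonde => dE.
  rewrite unitmxE unitfE; apply: contraTneq isT => W0; move: dE; rewrite W0 mulr0.
  move/eqP; rewrite eq_sym => /negPn; apply: contra => _.
  apply/prodf_neq0 => i _; apply/prodf_neq0 => j ij; rewrite !mxE subr_eq0.
  have := nth_uniq 0 _ _ uniq_cH; rewrite size_map sH => /(_ j i (ltn_ord j) (ltn_ord i)).
  by rewrite !(nth_map 0%N) ?sH // => ->; rewrite gtn_eqF.
have := congr1 (mulmx^~ (invmx W)) MW; rewrite mulmxK // => E.
rewrite -[_%:A]/(in_alg K _) -trace_map_mx E mxtrace_mulC mulKmx // mxtrace_diag.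
rewrite (big_nth 0%N) sH big_mkord.
by apply: eq_bigr => j _; rewrite mxE.
Qed.

(** * The trace inversion formula and the codifferent *)
Lemma h_gt0 : (0 < h)%N.
Proof.
have : (2 < N)%N by rewrite N_qp; have := q_gt0; have := p_doubleS; have := prime_gt1 p_prime; nia.
by rewrite N_doubleS; lia.
Qed.

Lemma character_sum m : 1 + \sum_(j < h) c (m * j.+1) = (if (N %| m)%N then N%:R else 0).
Proof.
apply: (fmorph_inj f); rewrite rmorphD rmorph1 rmorph_sum.
under eq_bigr => j _ do rewrite /= fcE !exprM.
case: ifPn => Nm.
  have zm : z ^+ m = 1 by apply/eqP; rewrite -(prim_order_dvd z_prim).
  rewrite exprVn zm invr1; under eq_bigr => j _ do rewrite expr1n.
  rewrite sumr_const card_ord rmorph_nat N_doubleS -(natr1 h.*2) addrC -muln2 natrM mulr_natl.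
  by rewrite -mulr2n.
rewrite rmorph0; apply: sum_unity_root.
- by rewrite -exprMn zzV expr1n.
- by rewrite -N_doubleS -exprM mulnC exprM (prim_expr_order z_prim) expr1n.
- by rewrite -(prim_order_dvd z_prim).
Qed.

Lemma c_mul k j : (0 < k)%N -> c (k * j) * c j = c (k.+1 * j) + c (k.-1 * j).
Proof.
case: k => // k _; apply: (fmorph_inj f); rewrite rmorphM rmorphD !fcE /= !mulSn !exprD.
have : z ^+ j * z^-1 ^+ j = 1 by rewrite -exprMn zzV expr1n.
by move: (z ^+ j) (z^-1 ^+ j) (z ^+ _) (z^-1 ^+ _) => a b d e ab; ring: ab.
Qed.

(** The product formula [c_mul] turns this into the character sums at k + 1 and
    k - 1; for 0 < k <= h, N divides only the second one, when k = 1. *)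
Lemma orthogonality k : (0 < k <= h)%N ->
  2 + \sum_(j < h) c (k * j.+1) * c j.+1 = (if k == 1%N then N%:R else 0).
Proof.
move=> /andP[k0 kh]; under eq_bigr => j _ do rewrite c_mul //.
rewrite big_split /= -[2]/(1 + 1 : K) addrACA !character_sum.
have Nk : (N %| k.+1)%N = false.
  by apply/negP => /(dvdn_leq (ltn0Sn _)); rewrite N_doubleS; have := h_gt0; lia.
have Nk' : (N %| k.-1)%N = (k == 1%N).
  case: k k0 kh {Nk} => [|[|k]] // _ kh; first by rewrite /= dvdn0.
  apply/negP => /(dvdn_leq (ltn0Sn _)); rewrite N_doubleS; lia.
by rewrite Nk Nk' add0r.
Qed.

Lemma galconj1 x : galconj 1 x = x.
Proof. by rewrite -[x in LHS]polyofK galconjE Euclid_dvd1 // c1 polyofK. Qed.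

(** Expand the traces into conjugates and exchange the sums: by orthogonality
    only the conjugate of index 1, x itself, survives. *)
Lemma trace_inversion x : N%:R * x =
  2 * (field_trace x)%:A + \sum_(j < h) (field_trace (x * c j.+1))%:A * c j.+1.
Proof.
rewrite field_traceE mulr_sumr.
under [X in _ = _ + X]eq_bigr => j _ do rewrite field_traceE mulr_suml.
rewrite exchange_big -big_split /=.
transitivity (\sum_(k <- H) galconj k x * (if k == 1%N then N%:R else 0)).
  rewrite (bigD1_seq 1%N) ?filter_uniq ?iota_uniq //=; last first.
    by rewrite mem_filter Euclid_dvd1 // mem_iota /= add1n ltnS h_gt0.
  rewrite galconj1 mulrC big1 ?addr0 // => k /negPf ->; exact: mulr0.
apply: eq_big_seq => k /memH[k0 kh pk]; rewrite -orthogonality ?k0 // mulrDr mulrC mulr_sumr.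
congr (_ + _); apply: eq_bigr => j _.
by rewrite rmorphM /= galconj_c // mulrA.
Qed.

Lemma O_sum (I : eqType) (s : seq I) (F : I -> K) :
  (forall i, i \in s -> O (F i)) -> O (\sum_(i <- s) F i).
Proof.
move=> OF; rewrite big_seq; elim/big_ind: _ => //; last exact: O_add.
exact: (O_int 0).
Qed.

Lemma trace_int x : O x -> field_trace x \is a Num.int.
Proof.
move=> Ox; apply: integral_rat_int; rewrite field_traceE.
by apply: O_sum => k _; apply: galconj_O.
Qed.

Definition codiff x := forall y, O y -> field_trace (x * y) \is a Num.int.

Lemma codiff_Zt x : codiff x -> in_Zt (N%:R * x).
Proof.
have Zt_alg a : a \is a Num.int -> in_Zt a%:A.
  by move=> /intrP[m ->]; rewrite -[_%:A]/(in_alg K _) rmorph_int; apply: Zt_int.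
move=> Mx; rewrite trace_inversion; apply: Zt_add.
  by apply: Zt_mul (Zt_int 2) (Zt_alg _ _); rewrite -[x]mulr1; apply/Mx/(O_int 1).
elim/big_ind: _ => [||j _]; [exact: (Zt_int 0)|exact: Zt_add|].
have Ac : in_Zt (c j.+1) by apply/Zt_dickson/Zt_t.
by apply: Zt_mul => //; apply/Zt_alg/Mx/Zt_O.
Qed.

Lemma codiff_mul x y : codiff x -> O y -> codiff (x * y).
Proof. by move=> Mx Oy u' Ou; rewrite -mulrA; apply/Mx/O_mul. Qed.

Lemma trace_add (x y : K) : field_trace (x + y) = field_trace x + field_trace y.
Proof.
apply: (fmorph_inj (in_alg K)); rewrite rmorphD /= !field_traceE -big_split.
by apply: eq_bigr => k _; rewrite rmorphD.
Qed.

Lemma codiff_add x y : codiff x -> codiff y -> codiff (x + y).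
Proof. by move=> Mx My v Ov; rewrite mulrDl trace_add rpredD // ?Mx ?My. Qed.

Lemma O_codiff x : O x -> codiff x.
Proof. by move=> Ox y Oy; apply/trace_int/O_mul. Qed.

(** N O is in Z[t] by inversion, N is a unit times a power of lam, and Z[t] is
    maximal at lam. *)
Lemma O_Zt x : O x -> in_Zt x.
Proof. by move=> Ox; apply: (@Zt_divNat _ r) => //; apply/codiff_Zt/O_codiff. Qed.

Lemma lam_nonunit : ~ O lam^-1.
Proof.
move=> Ol; have : (p %| 1)%Z by apply: p_dvd_lam Ol _; rewrite mulfV ?lam_neq0.
by rewrite dvdzE /= Euclid_dvd1.
Qed.

Lemma codiff_bound x : codiff x -> O (lam ^+ (n * r) * x).
Proof.
move=> /codiff_Zt; rewrite /N natrX p_lam exprMn -exprM => Ax; have [v Av wv] := w_unit.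
have -> : lam ^+ (n * r) * x = (v ^+ 2) ^+ r * (lam ^+ (n * r) * (w ^+ 2) ^+ r * x).
  have : (v ^+ 2) ^+ r * (w ^+ 2) ^+ r = 1.
    by rewrite -exprMn -exprMn [v * w]mulrC wv !expr1n.
  move: (lam ^+ _) ((v ^+ 2) ^+ r) ((w ^+ 2) ^+ r) => a b d bd; ring: bd.
by apply: Zt_O; apply: Zt_mul => //; do 2!apply: Zt_exp.
Qed.

(** If lam did not divide y, then y would be a unit modulo lam, hence modulo
    lam^E, and y lam^-E in the codifferent would bring lam^-E into it. *)
Lemma codiff_step E y : O y -> codiff (lam ^- E * y) ->
  ~ codiff (lam ^- E) -> exists2 y', O y' & y = lam * y'.
Proof.
move=> Oy My ME; have [m [a [/Zt_O Oa yE]]] := Zt_decomp (O_Zt Oy).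
case: (boolP (p %| m)%Z) => [/dvdzP[m' Em]|pm].
  exists (a + lam ^+ n.-1 * w ^+ 2 * m'%:~R).
    apply: O_add Oa _; apply: O_mul (O_int _).
    by apply/Zt_O/Zt_mul; apply: Zt_exp; [exact: Zt_lam|exact: Zt_w].
  rewrite yE Em rmorphM /= -pmulrn p_lam -[in LHS](prednK n_gt0) exprS; ring.
case: ME; have [s0 [k E1]] : exists s0 k : int, s0 * m = 1 + p%:Z * k.
  have /coprimezP[[s0 s1] /= e] : coprimez m p.
    by rewrite coprimez_sym coprimezE /= prime_coprime // -dvdzE.
  by exists s0, (- s1); rewrite -e; ring.
(* Normalize y to be 1 modulo lam: s0 inverts its residue m modulo p. *)
pose a' := lam ^+ n.-1 * w ^+ 2 * k%:~R + s0%:~R * a.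
have Oa' : O a'.
  apply: O_add; last exact: O_mul (O_int _) Oa.
  apply: O_mul (O_int _); apply/Zt_O/Zt_mul; apply: Zt_exp; [exact: Zt_lam|exact: Zt_w].
have sy : s0%:~R * y = 1 + lam * a'.
  have := congr1 (fun i : int => i%:~R : K) E1.
  rewrite rmorphD !rmorphM /= rmorph1 -pmulrn p_lam -[in _ ^+ n](prednK n_gt0) exprS => e.
  by rewrite yE mulrDr e /a'; ring.
(* The geometric sum inverts s0 y = 1 + lam a' up to a multiple of lam^E. *)
have -> : lam ^- E = lam ^- E * y * (s0%:~R * \sum_(i < E) (- (lam * a')) ^+ i) + (- a') ^+ E.
  rewrite -mulrA [y * _]mulrA [y * _]mulrC sy.
  have := subrX1 (- (lam * a')) E.
  set S := \sum_(i < E) _ => e.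
  have -> : (1 + lam * a') * S = 1 - (- (lam * a')) ^+ E.
    by rewrite -opprB e; ring.
  rewrite -mulrN exprMn mulrBr mulr1 mulrA mulVf ?mul1r ?subrK //.
  by rewrite expf_neq0 ?lam_neq0.
apply: codiff_add; last by apply/O_codiff/O_exp/O_opp.
apply: codiff_mul My _; apply: O_mul (O_int _) _; apply: O_sum => i _; apply/O_exp/O_opp.
by apply: O_mul Oa'; apply/Zt_O/Zt_lam.
Qed.

(** The exponent d is the largest one with lam^-d in the codifferent. *)
Lemma codiffE : exists d, forall x, codiff x <-> O (lam ^+ d * x).
Proof.
have Olam k : O (lam ^+ k) by apply/Zt_O/Zt_exp/Zt_lam.
have lk k : lam ^+ k != 0 by rewrite expf_neq0 ?lam_neq0.
have [d [Md MSd]] : exists d, codiff (lam ^- d) /\ ~ codiff (lam ^- d.+1).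
  apply: boolp.contrapT => nd.
  have all e : codiff (lam ^- e).
    elim: e => [|e IH]; first by rewrite expr0 invr1; apply/O_codiff/(O_int 1).
    by apply: boolp.contrapT => ne; apply: nd; exists e.
  (* All negative powers of lam in the codifferent would put lam^-1 in O. *)
  apply: lam_nonunit; have := codiff_bound (all (n * r).+1).
  by rewrite exprS invfM mulrCA mulfV ?lk // mulr1.
have Me e : ~ codiff (lam ^- (d + e).+1).
  move=> M1; apply: MSd; have := codiff_mul M1 (Olam e).
  by rewrite -addSn exprD invfM -mulrA mulVf ?lk // mulr1.
exists d => x; split=> [Mx|Ox]; last first.
  by rewrite -[x](mulKf (lk d)); apply: codiff_mul.
have : O (lam ^+ (d + n * r) * x).
  by rewrite exprD -mulrA; apply: O_mul (Olam _) _; apply: codiff_bound.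
(* Remove the superfluous factors lam one at a time. *)
elim: (n * r)%N => [|e IH]; first by rewrite addn0.
rewrite addnS => Oy; have Mx' : codiff (lam ^- (d + e).+1 * (lam ^+ (d + e).+1 * x)).
  by rewrite mulKf ?lk.
have [y' Oy' E] := codiff_step Oy Mx' (Me e); apply: IH.
have := E; rewrite exprS -mulrA => /(mulfI lam_neq0) ->; exact: Oy'.
Qed.

(** * Existence of modular lattices *)
Lemma lam_pos (R : realType) (s : {rmorphism K -> R}) : 0 < s lam.
Proof.
rewrite lt_neqAle eq_sym fmorph_eq0 lam_neq0 rmorphB rmorph_nat subr_ge0 leNgt /=.
apply/negP => lt2; have cN : c N = 2.
  apply: (fmorph_inj f).
  by rewrite fcE rmorph_nat exprVn (prim_expr_order z_prim) invr1.
have grow := dickson_growth lt2.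
have := congr1 s cN; rewrite /c rmorph_dickson rmorph_nat => E.
have [le2 _] := grow N.-1; have [_] := grow N.-1.
by rewrite prednK ?expn_gt0 ?prime_gt0 // E ltNge le2.
Qed.

(** The lattice is O with a = lam^(e-d), whose dual is lam^-e O. *)
Lemma modular_exists (R : realType) l e v v' :
  O v -> O v' -> v * v' = 1 -> l%:R = (lam ^+ e * v) ^+ 2 ->
  exists (I : set K) (a : K), ideal_lattice R I a /\ arakelov_modular l I a.
Proof.
move=> Ov Ov' vv' El; have [d dP] := codiffE.
have lk k : lam ^+ k != 0 by rewrite expf_neq0 ?lam_neq0.
pose a := lam ^+ e / lam ^+ d.
have dualE x : dual_ideal O a x <-> O (lam ^+ e * x).
  rewrite (_ : lam ^+ e * x = lam ^+ d * (a * x)); last first.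
    by rewrite /a mulrA [_ * (_ / _)]mulrC mulfVK ?lk.
  by rewrite -dP.
exists O, a; split; first split.
- split; first by exists 1; [apply: (O_int 1)|apply: oner_neq0].
  + exact: O_add.
  + exact: O_mul.
  + exists 1; split; [exact: (O_int 1)|exact: oner_neq0|by move=> x; rewrite mul1r].
- split; first by rewrite mulf_neq0 ?invr_eq0 ?lk.
  by move=> s; rewrite rmorphM fmorphV !rmorphXn divr_gt0 ?exprn_gt0 ?lam_pos.
exists (lam ^+ e * v); split => //.
  by rewrite mulf_neq0 ?lk //; apply: contra_eq_neq vv' => ->; rewrite mul0r eq_sym oner_neq0.
apply/seteqP; split => x /=.
  move=> Ox; exists (lam ^- e * (v' * x)).
    by apply/dualE; rewrite mulVKf ?lk //; apply: O_mul.
  rewrite mulrACA mulfV ?lk // mul1r mulrA vv' mul1r //.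
by case=> y0 /dualE Oy <-; rewrite mulrAC; apply: O_mul.
Qed.

Lemma intr_alg (m : int) : (m%:~R : rat)%:A = m%:~R :> K.
Proof. exact: (rmorph_int (in_alg K)). Qed.

Lemma integral_dvd (d m : nat) y : (0 < d)%N -> O y -> m%:R = d%:R * y -> (d %| m)%N.
Proof.
move=> d0 Oy E; have dr0 : d%:R != 0 :> rat by rewrite pnatr_eq0 -lt0n.
have /intrP[a Ea] : (m%:R / d%:R : rat) \is a Num.int.
  apply: integral_rat_int; rewrite -[_%:A]/(in_alg K _) fmorph_div !rmorph_nat E mulrC.
  by rewrite mulKf ?natrK_neq0.
suff : (d%:Z %| m%:Z)%Z by [].
apply/dvdzP; exists a; apply: (@intr_inj rat); rewrite rmorphM /= -Ea -!pmulrn.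
by rewrite divfK.
Qed.

(** * Necessary conditions on the level *)
Section Necessary.
Variables (l : nat) (b : K).
Hypotheses (l_gt0 : (0 < l)%N) (l_sqfree : square_free l) (b2 : l%:R = b ^+ 2).

Lemma O_b : O b.
Proof.
exists ('X^2 - (l%:Z)%:P); first exact: monicXnsubC.
by rewrite rmorphB /= map_polyXn map_polyC rootE !hornerE -b2 subrr.
Qed.

(** Each conjugate of b is b or -b, so the trace is b W with W integral, and
    its square l W^2 is a rational integer divisible by l. *)
Lemma trace_b_dvd s g : prime s -> (s %| l)%N -> O g ->
  exists m : int, field_trace (b * g) = (s%:Z * m)%:~R.
Proof.
move=> s_pr sl Og; have /intrP[m Em] := trace_int (O_mul O_b Og).
pose e k : K := if galconj k b == b then 1 else -1.
have eE k : galconj k b = b * e k.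
  rewrite /e; case: ifPn => [/eqP ->|ne]; first by rewrite mulr1.
  have /eqP : galconj k b ^+ 2 = b ^+ 2 by rewrite -rmorphXn -b2 rmorph_nat.
  by rewrite eqf_sqr (negPf ne) => /eqP ->; rewrite mulrN1.
pose W := \sum_(k <- H) e k * galconj k g.
have OW : O W.
  apply: O_sum => k _; apply: O_mul (galconj_O _ Og).
  by rewrite /e; case: ifP => _; [exact: (O_int 1)|exact: (O_int (-1))].
have mW : m%:~R = b * W.
  rewrite -intr_alg -Em field_traceE mulr_sumr; apply: eq_bigr => k _.
  by rewrite rmorphM /= eE mulrA.
have lm : (l %| `|m| ^ 2)%N.
  apply: (@integral_dvd _ _ (W ^+ 2)) => //; first exact: O_exp.
  by rewrite b2 -exprMn -mW -rmorphXn /= -abszX pmulrn gez0_abs // sqr_ge0.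
have : (s %| m)%Z.
  by rewrite dvdzE /=; have := dvdn_trans sl lm; rewrite Euclid_dvdX // => /andP[].
by case/dvdzP => m' E'; exists m'; rewrite Em E' mulrC.
Qed.

(** By trace inversion s divides N b in O, hence s^2 divides N^2 l; for s other
    than p this contradicts the square-freeness of l. *)
Lemma prime_dvd_level s : prime s -> (s %| l)%N -> s = p.
Proof.
move=> s_pr sl; apply/eqP; apply: contraT => sp.
have [a Oa Ea] : exists2 a, O a & N%:R * b = s%:R * a.
  pose D x := exists2 a, O a & x = s%:R * a.
  have D_add x y : D x -> D y -> D (x + y).
    by move=> [a Oa ->] [a' Oa' ->]; exists (a + a'); [exact: O_add|rewrite mulrDr].
  have D_tr g : O g -> D (field_trace (b * g))%:A.
    move=> Og; have [m ->] := trace_b_dvd s_pr sl Og.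
    by exists m%:~R; [exact: O_int|rewrite intr_alg rmorphM].
  have D_mul x y : D x -> O y -> D (x * y).
    by move=> [a Oa ->] Oy; exists (a * y); [exact: O_mul|rewrite mulrA].
  rewrite trace_inversion; apply: (D_add).
    by rewrite mulrC -[b]mulr1; apply: D_mul (O_int 2); apply/D_tr/(O_int 1).
  elim/big_ind: _ => [||j _]; [|exact: D_add|].
    by exists 0; [exact: (O_int 0)|rewrite mulr0].
  have Oc : O (c j.+1) by apply/Zt_O/Zt_dickson/Zt_t.
  exact/D_mul/Oc/D_tr.
(* This is (N b)^2 = s^2 a^2, read in the rational integers. *)
have : (s ^ 2 %| N ^ 2 * l)%N.
  apply: (@integral_dvd _ _ (a ^+ 2)); [by rewrite expn_gt0 prime_gt0|exact: O_exp|].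
  by rewrite natrM [(N ^ 2)%:R]natrX [(s ^ 2)%:R]natrX b2 -!exprMn Ea.
rewrite Gauss_dvdr => [/l_sqfree s1|]; first by rewrite s1 in s_pr.
by rewrite /N -expnM coprimeXl // coprimeXr // prime_coprime // dvdn_prime2.
Qed.

Lemma level_cases : l = 1%N \/ l = p.
Proof.
case: (ltngtP l 1) => [|l1|]; [by lia| |by left]; right.
have := pdiv_dvd l; have pl := pdiv_prime l1.
rewrite (prime_dvd_level pl (pdiv_dvd l)) => /dvdnP[l' El].
suff: l' = 1%N by rewrite El => ->; rewrite mul1n.
apply/eqP; apply: contraT => l'1; have l'2 : (1 < l')%N by lia.
have pl' := pdiv_prime l'2.
have E' : pdiv l' = p.
  by apply: prime_dvd_level => //; rewrite El dvdn_mulr ?pdiv_dvd.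
have /l_sqfree p1 : (p ^ 2 %| l)%N by rewrite El dvdn_mul // -E' pdiv_dvd.
by have := prime_gt1 p_prime; rewrite p1.
Qed.

(** Q(b) is a quadratic subfield of K, so 2 divides n. *)
Lemma level_p_even : l = p -> ~~ odd n.
Proof.
move=> lp; have b1 : b \notin 1%AS.
  apply/negP => /vlineP[a Ea].
  have /intrP[m Em] : a \is a Num.int by apply: integral_rat_int; rewrite -Ea; exact: O_b.
  have : (m ^+ 2)%R = p%:Z.
    apply: (@intr_inj rat); apply: (fmorph_inj (in_alg K)).
    rewrite rmorphXn rmorphXn /= -Em -Ea -b2 lp intr_alg.
    by rewrite -pmulrn.
  move/(congr1 absz); rewrite abszX /= => /(congr1 (logn p)).
  by rewrite lognX (@logn_prime p p p_prime) => /(congr1 odd); rewrite oddM /= eqxx.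
have deg2 : adjoin_degree 1%AS b = 2.
  apply/eqP; rewrite eqn_leq; apply/andP; split; last first.
    by rewrite ltn_neqAle eq_sym adjoin_deg_eq1 b1.
  have : minPoly 1 b %| 'X^2 - (l%:R)%:P.
    apply: minPoly_dvdp; last by rewrite rootE !hornerE b2 subrr.
    by rewrite rpredB ?rpredX ?polyOverX // polyOverC rpred_nat.
  move/dvdp_leq; rewrite size_minPoly size_XnsubC //; apply.
  by rewrite -size_poly_eq0 size_XnsubC.
have := field_dimS (subvf <<1%AS; b>>%AS); rewrite dim_K dim_Fadjoin deg2 dimv1 muln1.
by rewrite dvdn2.
Qed.

End Necessary.

Lemma modular_levels (R : realType) l : (0 < l)%N -> square_free l ->
  (exists (I : set K) (a : K), ideal_lattice R I a /\ arakelov_modular l I a)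
  <-> l \in Mod p.
Proof.
move=> l0 lsq; have oq : odd q by rewrite oddX p_odd orbT.
have p4 : (p %% 4 = 1 /\ ~~ odd p./2 \/ p %% 4 = 3 /\ odd p./2)%N.
  have := p_doubleS; have := odd_double_half p./2; case: (odd p./2) => /= *; [right|left]; split => //; lia.
have on : odd n = odd p./2 by rewrite oddM oq.
split=> [[I [a [_ [b [_ _ b2]]]]]|].
  rewrite /Mod; case: (level_cases l0 lsq b2) => El.
    by case: p4 => -[-> _]; rewrite El /= ?in_cons ?eqxx.
  have := level_p_even b2 El; rewrite on.
  by case: p4 => -[-> ->] //= _; rewrite El !in_cons eqxx orbT.
have mod1 : exists (I : set K) (a : K), ideal_lattice R I a /\ arakelov_modular 1 I a.
  apply: (@modular_exists R 1 0 1 1); rewrite ?expr0 ?mulr1 ?expr1n //; exact: (O_int 1).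
rewrite /Mod; case: p4 => -[-> op] /=; rewrite !in_cons in_nil orbF; last by move/eqP ->.
case/orP => /eqP -> //.
have [v Av wv] := w_unit.
apply: (@modular_exists R p n./2 w v _ _ wv); [exact/Zt_O/Zt_w|exact: Zt_O|].
rewrite p_lam exprMn -exprM muln2 -[in LHS](odd_double_half n) on (negPf op) add0n.
by [].
Qed.

End RealCyclotomic.

Lemma real_subfield_gen (L : fieldExtType rat) (z : L) (t : real_subfield z) :
  vsval t = z + z^-1 -> forall x : real_subfield z,
  exists P : {poly rat}, x = (map_poly (in_alg (real_subfield z)) P).[t].
Proof.
move=> tE x; have xK : vsval x \in <<1%AS; z + z^-1>>%VS by exact: subvsP.
have [P PE] := polyOver1P (Fadjoin_polyOver 1%AS (z + z^-1) (vsval x)).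
exists P; apply: val_inj; rewrite /= -(Fadjoin_poly_eq xK) PE.
rewrite -[RHS]horner_map -map_poly_comp /= tE; congr (_.[_]).
by apply: eq_map_poly => a; rewrite [RHS]linearZ /= algid1.
Qed.

Theorem proposition4p8 (R : realType) (p r l : nat)
    (p_prime : prime p) (p_odd : odd p) (r_gt0 : (0 < r)%N)
    (l_gt0 : (0 < l)%N) (l_sqfree : square_free l)
    (L : fieldExtType rat) (z : L)
    (z_prim : (p ^ r)%N.-primitive_root z) :
  (exists (I : set (real_subfield z)) (a : real_subfield z),
     ideal_lattice R I a /\ arakelov_modular l I a)
  <-> l \in Mod p.
Proof.
have tK : z + z^-1 \in <<1; z + z^-1>>%VS by apply: memv_adjoin.
have tE : vsval (Subvs tK) = z + z^-1 by [].
exact: (modular_levels p_prime p_odd r_gt0 z_prim tE (real_subfield_gen tE)).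
Qed.
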